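(* Suppose the revival periods are in resonance: there are nonzero rationals $\frac{p_1}{q_1},\frac{p_2}{q_2},\frac{p_{12}}{q_{12}}$ with $\frac{p_1}{q_1}T_{rev_1}=\frac{p_2}{q_2}T_{rev_2}=\frac{p_{12}}{q_{12}}T_{rev_{12}}=:T_{frac}$. Let $r_j:=p_{12}q_j$, $s_j:=q_{12}p_j$ ($j=1,2$) and let $\ell_1,\ell_2\geq1$ be integers such that for all $(n,m)\in\mathbb{Z}^2$ $$\frac{\ell_1^2p_1}{q_1}+\frac{2p_1\ell_1}{q_1}n+\frac{p_1r_1\ell_1}{s_1q_1}m\in\mathbb{Z},\qquad \frac{\ell_2^2p_2}{q_2}+\frac{2p_2\ell_2}{q_2}m+\frac{p_2r_2\ell_2}{s_2q_2}n\in\mathbb{Z}.$$ Then $$\mathbf{a_2}(T_{frac})=\sum_{k_1=0}^{\ell_1-1}\sum_{k_2=0}^{\ell_2-1}c_{k_1,k_2}\,\psi_{cl}\Big(T_{frac}+\frac{k_1}{\ell_1}T_{scl_1},\,T_{frac}+\frac{k_2}{\ell_2}T_{scl_2}\Big),$$ where $c_{k_1,k_2}=e^{-\frac{2i\pi k_1n_0}{\ell_1}}e^{-\frac{2i\pi k_2m_0}{\ell_2}}b_{k_1,k_2}$, $b_{k_1,k_2}=\frac{1}{\ell_1\ell_2}\sum_{n=0}^{\ell_1-1}\sum_{m=0}^{\ell_2-1}\theta_{n,m}e^{\frac{2i\pi k_1n}{\ell_1}}e^{\frac{2i\pi k_2m}{\ell_2}}$ and $\theta_{n,m}:=e^{-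2i\pi\left(\frac{p_1}{q_1}(n-n_0)^2+\frac{p_{12}}{q_{12}}(n-n_0)(m-m_0)+\frac{p_2}{q_2}(m-m_0)^2\right)}$.
   Context: Setting. Fix $\omega_1,\omega_2>0$, a polynomial $F\in\mathbb{R}[X,Y]$ not depending on $h$, a point $(E_1,E_2)\in\,]0,1]^2$, exponents $\delta_1',\delta_2'\in\,]0,1[$ and a nonnegative, not identically zero function $\chi\in\mathcal{S}(\mathbb{R}^2)$. $h>0$ is a sufficiently small parameter. For integers $n,m$ put $\tau_n:=\omega_1h(n+\tfrac12)$, $\mu_m:=\omega_2h(m+\tfrac12)$. Let $n_0=n_0(h)$ (resp. $m_0=m_0(h)$) be the integer in $\mathbb{N}=\{0,1,2,\dots\}$ minimizing $|\tau_n-E_1|$ (resp. $|\mu_m-E_2|$), assumed unique. For $(n,m)\in\mathbb{Z}^2$ put $$a_{n,m}:=K_h\,\chi\Big(\frac{\tau_n-\tau_{n_0}}{h^{\delta_1'}},\frac{\mu_m-\mu_{m_0}}{h^{\delta_2'}}\Big),\qquad K_h:=\Big\|\chi\Big(\frac{\tau_n-\tau_{n_0}}{h^{\delta_1'}},\frac{\mu_m-\mu_{m_0}}{h^{\delta_2'}}\Big)\Big\|_{\ell^2(\mathbb{N}^2)}^{-1}.$$ Assume $\frac{\partial F}{\partial X},\frac{\partial F}{\partial Y},\frac{\partial^2F}{\partial X^2},\frac{\partial^2F}{\partial X\partial Y},\frac{\partial^2F}{\partial Y^2}$ are all nonzero at $(E_1,E_2)$. Semi-classical periods: $T_{scl_1}:=\frac{2\pi}{\omega_1\frac{\partial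 F}{\partial X}(\tau_{n_0},\mu_{m_0})}$, $T_{scl_2}:=\frac{2\pi}{\omega_2\frac{\partial F}{\partial Y}(\tau_{n_0},\mu_{m_0})}$ (well defined for small $h$). Revival periods: $$T_{rev_1}:=\frac{4\pi}{h\,\omega_1^2\frac{\partial^2F}{\partial X^2}(E_1,E_2)},\quad T_{rev_2}:=\frac{4\pi}{h\,\omega_2^2\frac{\partial^2F}{\partial Y^2}(E_1,E_2)},\quad T_{rev_{12}}:=\frac{4\pi}{h\,\omega_1\omega_2\frac{\partial^2F}{\partial X\partial Y}(E_1,E_2)}.$$ Define $$\mathbf{a_2}(t):=\sum_{(n,m)\in\mathbb{N}^2}|a_{n,m}|^2e^{-2i\pi t\left(\frac{n-n_0}{T_{scl_1}}+\frac{m-m_0}{T_{scl_2}}+\frac{(n-n_0)^2}{T_{rev_1}}+\frac{(m-m_0)^2}{T_{rev_2}}+\frac{(n-n_0)(m-m_0)}{T_{rev_{12}}}\right)},$$ $$\psi_{cl}(t_1,t_2):=\sum_{(n,m)\in\mathbb{N}^2}|a_{n,m}|^2e^{-2i\pi t_1\frac{n-n_0}{T_{scl_1}}-2i\pi t_2\frac{m-m_0}{T_{scl_2}}}.$$ *)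

(* Defs.v *)
From HB Require Import structures.
From mathcomp Require Import all_boot all_order all_algebra.
From mathcomp Require Import all_classical all_reals all_analysis.
From mathcomp.analysis.showcase Require summability.
From mathcomp Require Export complex.

Set Implicit Arguments.
Unset Strict Implicit.
Unset Printing Implicit Defensive.

Import Order.TTheory GRing.Theory Num.Theory.
Import numFieldNormedType.Exports.

Local Open Scope classical_set_scope.
Local Open Scope ring_scope.
Local Open Scope complex_scope.

(* The outer variable of {poly {poly R}} is X and the inner one is Y, so the
   value of F at (x, y) is F.[x%:P].[y], as in polyXY. *)
Definition dX (R : realType) (F : {poly {poly R}}) : {poly {poly R}} := F^`().

Definition dY (R : realType) (F : {poly {poly R}}) : {poly {poly R}} :=
  map_poly (@deriv R) F.

Definition partial (R : realType) (second : bool) (f : R * R -> R) :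
    R * R -> R :=
  fun p => 'D_(if second then (0, 1) else (1, 0)) f p.

(* The word w lists the variables of an iterated partial derivative; allowing
   every word avoids relying on the symmetry of mixed derivatives. *)
Definition partials (R : realType) (w : seq bool) (f : R * R -> R) :
    R * R -> R :=
  foldr (@partial R) f w.

Definition schwartz (R : realType) (f : R * R -> R) : Prop :=
  forall w : seq bool,
    (forall p : R * R, differentiable (partials w f) p) /\
    (forall i j : nat, exists M : R, forall p : R * R,
       `|p.1| ^+ i * `|p.2| ^+ j * `|partials w f p| <= M).

Definition level (R : realType) (omega h : R) (n : int) : R :=
  omega * h * (n%:~R + 2^-1).

Definition unique_nearest (R : realType) (u : int -> R) (E : R) (n0 : nat) :
    Prop :=
  forall n : nat, n != n0 -> `|u n0%:Z - E| < `|u n%:Z - E|.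

(* Unconditional sum over N^2: limit of the finite partial sums along the
   finite subsets of N^2 ordered by inclusion. *)
Definition sum2 (K : numFieldType) (f : nat -> nat -> K) : K :=
  summability.sum (fun nm : nat * nat => f nm.1 nm.2 : K^o).

Definition l2norm (R : realType) (f : int -> int -> R) : R :=
  Num.sqrt (sum2 (fun n m : nat => `|f n%:Z m%:Z| ^+ 2)).

Definition coef (R : realType) (chi : R * R -> R) (tau mu : int -> R)
    (n0 m0 : nat) (h delta1 delta2 : R) : int -> int -> R :=
  let g := fun n m : int => chi ((tau n - tau n0%:Z) / h `^ delta1,
                                 (mu m - mu m0%:Z) / h `^ delta2) in
  fun n m => (l2norm g)^-1 * g n m.

(* exp (i x) *)
Definition expi (R : realType) (x : R) : R[i] := cos x +i* sin x.

Definition a2 (R : realType) (a : int -> int -> R) (n0 m0 : nat)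
    (Tscl1 Tscl2 Trev1 Trev2 Trev12 : R) (t : R) : R[i] :=
  sum2 (fun n m : nat =>
    let dn : R := n%:R - n0%:R in
    let dm : R := m%:R - m0%:R in
    (`|a n%:Z m%:Z| ^+ 2)%:C *
    expi (- (2 * pi * t *
      (dn / Tscl1 + dm / Tscl2 + dn ^+ 2 / Trev1 + dm ^+ 2 / Trev2
       + dn * dm / Trev12)))).

Definition psi_cl (R : realType) (a : int -> int -> R) (n0 m0 : nat)
    (Tscl1 Tscl2 : R) (t1 t2 : R) : R[i] :=
  sum2 (fun n m : nat =>
    let dn : R := n%:R - n0%:R in
    let dm : R := m%:R - m0%:R in
    (`|a n%:Z m%:Z| ^+ 2)%:C *
    expi (- (2 * pi * t1 * (dn / Tscl1)) - 2 * pi * t2 * (dm / Tscl2))).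

(* In theta, bcoef and ccoef, rho1, rho2 and rho12 stand for p1 / q1, p2 / q2
   and p12 / q12. *)
Definition theta (R : realType) (rho1 rho2 rho12 : R) (n0 m0 : nat)
    (n m : int) : R[i] :=
  let dn : R := n%:~R - n0%:R in
  let dm : R := m%:~R - m0%:R in
  expi (- (2 * pi * (rho1 * dn ^+ 2 + rho12 * (dn * dm) + rho2 * dm ^+ 2))).

Definition bcoef (R : realType) (rho1 rho2 rho12 : R) (n0 m0 l1 l2 : nat)
    (k1 k2 : nat) : R[i] :=
  (l1%:R * l2%:R)^-1 *
  \sum_(n < l1) \sum_(m < l2)
    theta rho1 rho2 rho12 n0 m0 (n : nat)%:Z (m : nat)%:Z *
    expi (2 * pi * k1%:R * n%:R / l1%:R) *
    expi (2 * pi * k2%:R * m%:R / l2%:R).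

Definition ccoef (R : realType) (rho1 rho2 rho12 : R) (n0 m0 l1 l2 : nat)
    (k1 k2 : nat) : R[i] :=
  expi (- (2 * pi * k1%:R * n0%:R / l1%:R)) *
  expi (- (2 * pi * k2%:R * m0%:R / l2%:R)) *
  bcoef rho1 rho2 rho12 n0 m0 l1 l2 k1 k2.

(* Main.v *)
(** On the resonance, the quadratic part of the phase of [a2] at [Tfrac] is the
    sequence [theta], which by the integrality conditions is l1-periodic in n
    and l2-periodic in m. Discrete Fourier inversion on Z/l1 x Z/l2 writes
    [theta] as a finite combination of characters, and the character of index
    (k1, k2) amounts to shifting the two times of [psi_cl] by (k1/l1) Tscl1
    and (k2/l2) Tscl2. Splitting the sum needs the convergence of each
    [psi_cl], which follows from the Schwartz decay of chi; undoing the
    division by Tscl1 and Tscl2 needs the first derivatives of F not to vanish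
    at the nearest lattice point, which holds for small h because that point
    tends to (E1, E2). *)

Require Import Defs.
From mathcomp Require Import all_boot all_order all_algebra finmap.
From mathcomp Require Import all_classical all_reals all_analysis.
From mathcomp Require Import ring lra.

Set Implicit Arguments.
Unset Strict Implicit.

Import Order.TTheory GRing.Theory Num.Theory.
Import numFieldNormedType.Exports.
Local Open Scope classical_set_scope.
Local Open Scope ring_scope.
Local Open Scope complex_scope.
#[local] Existing Instance summability.totally_filter.

Import summability.

Local Notation re := (@complex.Re _).
Local Notation im := (@complex.Im _).

(** * Unconditional sums over finite subsets: convergence and linearity *)

Lemma partial_sumE (I : choiceType) (V : zmodType) (x : I -> V) (J : {fset I}) :
  partial_sum x J = \sum_(i <- J) x i.
Proof. by rewrite /partial_sum big_seq_fsetE. Qed.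

(** Stated for duplicate-free sequences so that it compares finite sets with each other and also
    with a rectangle of pairs. *)
Lemma sum_uniq_subset_le (I : eqType) (R : numDomainType) (f : I -> R)
    (s t : seq I) : (forall i, 0 <= f i) -> uniq s -> uniq t ->
  {subset s <= t} -> \sum_(i <- s) f i <= \sum_(i <- t) f i.
Proof.
move=> f_ge0 us ut st.
rewrite [leRHS](bigID (mem s)) /= -[leLHS]addr0 lerD ?sumr_ge0//.
have s_perm : perm_eq s (seq.filter (mem s) t).
  apply: uniq_perm => //; first exact: filter_uniq.
  by move=> i; rewrite mem_filter; apply/idP/andP => [si|[]//]; split=> //; apply: st.
by rewrite (perm_big _ s_perm) big_filter.
Qed.

(** The limit is the supremum of the partial sums: some [J] comes within [e] of it, and by
    monotonicity so does every larger set. *)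
Lemma partial_sum_cvg_ge0 (I : choiceType) (R : realType) (u : I -> R) (M : R) :
  (forall i, 0 <= u i) -> (forall J : {fset I}, partial_sum u J <= M) ->
  cvg ((partial_sum u : _ -> R^o) @ totally).
Proof.
move=> u_ge0 uM.
have hs : has_sup (range (partial_sum u)).
  split; first by exists (partial_sum u fset0), fset0.
  by exists M => _ [J _ <-].
apply/cvg_ex; exists (sup (range (partial_sum u))).
apply/cvgrPdist_lt => e e0.
have [_ [J _ <-] Je] := sup_adherent e0 hs.
exists J => //= K JK.
have JK' : partial_sum u J <= partial_sum u K.
  rewrite !partial_sumE; apply: sum_uniq_subset_le => //.
  by move=> i; apply: (fsubsetP JK).
have KM : partial_sum u K <= sup (range (partial_sum u)).
  by apply: sup_upper_bound => //; exists K.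
by rewrite ger0_norm ?subr_ge0//; lra.
Qed.

Lemma partial_sum_cvg_dominated (I : choiceType) (R : realType)
    (f u : I -> R) (M : R) :
  (forall i, `|f i| <= u i) -> (forall J : {fset I}, partial_sum u J <= M) ->
  cvg ((partial_sum f : _ -> R^o) @ totally).
Proof.
move=> fu uM.
have u_ge0 i : 0 <= u i by rewrite (le_trans _ (fu i)).
have cu := partial_sum_cvg_ge0 u_ge0 uM.
(* f = (f + u) - u, a difference of nonnegative families *)
have cfu : cvg ((partial_sum (fun i => f i + u i) : _ -> R^o) @ totally).
  apply: (@partial_sum_cvg_ge0 _ _ _ (M + M)) => [i|J].
    by have := fu i; rewrite ler_norml => /andP[+ _]; rewrite -subr_ge0 opprK.
  rewrite partial_sumE big_split/= -!partial_sumE lerD//.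
  apply: le_trans (uM J); rewrite !partial_sumE ler_sum// => i _.
  exact: le_trans (ler_norm _) (fu i).
have -> : partial_sum f = (fun J => partial_sum (fun i => f i + u i) J - partial_sum u J).
  by apply/funext => J; rewrite !partial_sumE big_split/= addrK.
exact: (@is_cvgB R R^o).
Qed.

Lemma complex_cvg (T : Type) (F : set_system T) (FF : Filter F) (R : realType)
    (f : T -> R[i]) (a b : R) :
  re \o f @ F --> (a : R^o) -> im \o f @ F --> (b : R^o) ->
  (f : T -> R[i]^o) @ F --> (a +i* b : R[i]^o).
Proof.
move=> fa fb; apply/(@cvgrPdist_lt R[i] R[i]^o) => -[e e'].
(* In the partial order of [R[i]], a positive [e +i* e'] has [e' = 0] and [e > 0]. *)
rewrite ltcE/= => /andP[/eqP -> e0].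
have e20 : 0 < e / 2 by lra.
move/cvgrPdist_lt : fa => /(_ _ e20) fa; move/cvgrPdist_lt : fb => /(_ _ e20) fb.
near=> t.
have At : `|a - re (f t)| < e / 2 by near: t.
have Bt : `|b - im (f t)| < e / 2 by near: t.
case: (f t) At Bt => x y /=.
set p := `|a - x|; set q := `|b - y| => At Bt.
have p0 : 0 <= p by exact: normr_ge0.
have q0 : 0 <= q by exact: normr_ge0.
rewrite normc_def/= ltcR.
have -> : (a - x) ^+ 2 + (b - y) ^+ 2 = p ^+ 2 + q ^+ 2 by rewrite !real_normK ?num_real.
have -> : e = Num.sqrt (e ^+ 2) by rewrite sqrtr_sqr ger0_norm// ltW.
by rewrite ltr_sqrt ?exprn_gt0//; nra.
Unshelve. all: by end_near. Qed.

(** The real and imaginary parts are both dominated by the modulus, hence by [u]. *)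
Lemma partial_sum_cvg_complex (I : choiceType) (R : realType)
    (f : I -> R[i]) (u : I -> R) (M : R) :
  (forall i, `|f i| <= (u i)%:C) ->
  (forall J : {fset I}, partial_sum u J <= M) ->
  cvg ((partial_sum f : _ -> R[i]^o) @ totally).
Proof.
move=> fu uM.
have cRe : cvg ((partial_sum (re \o f) : _ -> R^o) @ totally).
  apply: partial_sum_cvg_dominated uM => i.
  by rewrite -lecR (le_trans (normc_ge_Re _)).
have cIm : cvg ((partial_sum (im \o f) : _ -> R^o) @ totally).
  apply: partial_sum_cvg_dominated uM => i.
  rewrite -lecR (le_trans _ (fu i))// normc_def lecR/= -sqrtr_sqr.
  by rewrite ler_wsqrtr// lerDr sqr_ge0.
apply/cvg_ex; eexists; apply: (@complex_cvg _ totally).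
- rewrite (_ : _ \o _ = partial_sum (re \o f)); first exact: cRe.
  by apply/funext => J; rewrite /= !partial_sumE raddf_sum.
- rewrite (_ : _ \o _ = partial_sum (im \o f)); first exact: cIm.
  by apply/funext => J; rewrite /= !partial_sumE raddf_sum.
Qed.

(** Convergence of each family is required because [sum2] is a limit operator, with a default value
    on divergent families. *)
Lemma sum2_lincomb (K : numFieldType) (J : finType) (c : J -> K)
    (f : J -> nat -> nat -> K) :
  (forall j, cvg ((partial_sum (fun nm : nat * nat => f j nm.1 nm.2) : _ -> K^o) @ totally)) ->
  sum2 (fun n m => \sum_j c j * f j n m) = \sum_j c j * sum2 (f j).
Proof.
move=> cf; rewrite /sum2 /summability.sum; apply: cvg_lim => //.
rewrite (_ : partial_sum _ =
  (fun A => \sum_j c j * partial_sum (fun nm => f j nm.1 nm.2) A)); last first.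
  apply/funext => A; rewrite partial_sumE exchange_big/=.
  by apply: eq_bigr => j _; rewrite partial_sumE mulr_sumr.
apply: (@cvg_big K^o) => [|j _]; first exact: (@add_continuous K^o).
by apply: (@cvgM K); [exact: cvg_cst | exact: cf].
Qed.

(** * Square summability of a Schwartz function on a lattice *)

Lemma sum_inv_telescope (R : realFieldType) (n : nat) :
  \sum_(i < n) ((i.+1 * i.+2)%:R : R)^-1 <= 1.
Proof.
suff -> : \sum_(i < n) ((i.+1 * i.+2)%:R : R)^-1 = 1 - n.+1%:R^-1.
  by rewrite gerBl invr_ge0.
elim: n => [|n IH]; first by rewrite big_ord0 invr1 subrr.
rewrite big_ord_recr/= IH natrM -!natr1.
have n0 : 0 <= n%:R :> R by [].
by field; rewrite !lt0r_neq0//; lra.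
Qed.

(* Termwise comparison with 1 / ((i + 1)(i + 2)), using
   (i + 1)(i + 2) <= 2 (i + 1)^2 <= 4 (i - n0)^2 + 4 (n0 + 1)^2. *)
Lemma sum_inv_shifted_sqr (R : realFieldType) (alpha : R) (n0 n : nat) :
  alpha != 0 ->
  \sum_(i < n) (1 + alpha ^+ 2 * (i%:R - n0%:R) ^+ 2)^-1
    <= 4 / alpha ^+ 2 + 4 * n0.+1%:R ^+ 2.
Proof.
move=> alpha0; set C := leRHS.
have a0 : 0 < alpha ^+ 2 by rewrite exprn_even_gt0.
have C0 : 0 <= C by rewrite addr_ge0// ?mulr_ge0// ?sqr_ge0// invr_ge0 ltW.
rewrite -[leRHS]mulr1; apply: le_trans (ler_wpM2l C0 (sum_inv_telescope R n)).
rewrite mulr_sumr; apply: ler_sum => i _.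
set d := i%:R - n0%:R.
have d2 : 0 <= d ^+ 2 by rewrite sqr_ge0.
have D0 : 0 < 1 + alpha ^+ 2 * d ^+ 2 by nra.
have N0 : 0 < (i.+1 * i.+2)%:R :> R by rewrite ltr0n.
rewrite ler_pdivlMr// mulrC ler_pdivrMr//.
have NE : (i.+1 * i.+2)%:R = (d + n0.+1%:R) * (d + n0.+1%:R + 1) :> R.
  by rewrite /d natrM -!natr1; ring.
have d1 : 1 <= d + n0.+1%:R by rewrite /d -natr1; have := ler0n R i; lra.
have N_le : (i.+1 * i.+2)%:R <= 4 * d ^+ 2 + 4 * n0.+1%:R ^+ 2 :> R.
  rewrite NE; move: (n0.+1%:R) d1 => b d1.
  have := sqr_ge0 (d - b); nra.
apply: le_trans N_le _.
(* The summand [4 / alpha ^+ 2] of [C] is chosen to give [4 * d ^+ 2] once multiplied by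
   [alpha ^+ 2 * d ^+ 2]; the two surplus terms are nonnegative. *)
have -> : C * (1 + alpha ^+ 2 * d ^+ 2)
  = 4 / alpha ^+ 2 + 4 * n0.+1%:R ^+ 2 + 4 * d ^+ 2
    + 4 * n0.+1%:R ^+ 2 * (alpha ^+ 2 * d ^+ 2) by rewrite /C; field.
have t1 : 0 <= 4 / alpha ^+ 2 by rewrite divr_ge0// ltW.
have t2 : 0 <= 4 * n0.+1%:R ^+ 2 * (alpha ^+ 2 * d ^+ 2) by rewrite !(sqr_ge0, mulr_ge0).
lra.
Qed.

(** [J] lies in a square [0, N) x [0, N), over which the sum of the products factors. *)
Lemma partial_sum_prod_le (R : realFieldType) (u v : nat -> R) (A B : R)
    (J : {fset nat * nat}) :
  (forall n, 0 <= u n) -> (forall n, 0 <= v n) ->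
  (forall n, \sum_(i < n) u i <= A) -> (forall n, \sum_(i < n) v i <= B) ->
  partial_sum (fun nm => u nm.1 * v nm.2) J <= A * B.
Proof.
move=> u0 v0 uA vB.
pose N := (\max_(nm <- J) (maxn nm.1 nm.2).+1)%N.
have J_sub : {subset J <= [seq (n, m) | n <- iota 0 N, m <- iota 0 N]}.
  move=> [n m] Jnm; rewrite allpairs_f// mem_iota add0n/=.
    exact: leq_trans (leq_ltn_trans (leq_maxl n m) _) (leq_bigmax_seq _ Jnm isT).
  exact: leq_trans (leq_ltn_trans (leq_maxr n m) _) (leq_bigmax_seq _ Jnm isT).
rewrite partial_sumE.
apply: le_trans (sum_uniq_subset_le _ (fset_uniq J) _ J_sub) _.
- by move=> nm; rewrite mulr_ge0.
- by rewrite allpairs_uniq ?iota_uniq// => -[? ?] [? ?].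
rewrite big_allpairs/=.
under eq_bigr do rewrite -mulr_sumr.
rewrite -mulr_suml -{1 2}[N]subn0 -!/(index_iota 0 N) !big_mkord.
by rewrite ler_pM ?sumr_ge0.
Qed.

(** Expanding the weight gives the monomials 1, x^2, y^2 and x^2 y^2, each controlled by the decay
    of [chi] itself (the empty word). *)
Lemma schwartz_decay (R : realType) (chi : R * R -> R) : schwartz chi ->
  exists M : R, forall p, (1 + p.1 ^+ 2) * (1 + p.2 ^+ 2) * `|chi p| <= M.
Proof.
move=> /(_ [::]) [_ /= chiM].
have [M00 H00] := chiM 0 0; have [M20 H20] := chiM 2 0.
have [M02 H02] := chiM 0 2; have [M22 H22] := chiM 2 2.
exists (M00 + M20 + M02 + M22) => p.
move: {H00 H20 H02 H22} (H00 p) (H20 p) (H02 p) (H22 p).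
rewrite !expr0 !real_normK ?num_real// !mul1r !mulr1; lra.
Qed.

Lemma schwartz_lattice_sqr_bound (R : realType) (chi : R * R -> R)
    (alpha beta c : R) (n0 m0 : nat) :
  schwartz chi -> alpha != 0 -> beta != 0 ->
  exists M : R, forall J : {fset nat * nat},
    partial_sum (fun nm => `|c * chi (alpha * (nm.1%:R - n0%:R),
                                      beta * (nm.2%:R - m0%:R))| ^+ 2) J <= M.
Proof.
move=> /schwartz_decay[M chiM] alpha0 beta0.
pose w (a : R) (k n : nat) : R := (1 + a ^+ 2 * (n%:R - k%:R) ^+ 2)^-1.
have w_ge0 a k n : 0 <= w a k n.
  by rewrite invr_ge0 addr_ge0// mulr_ge0// sqr_ge0.
(* The witness is fixed by unification below: [(c * M) ^+ 2] times the product of the two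
   one-dimensional bounds. *)
eexists => J.
apply: le_trans (_ : (c * M) ^+ 2 * partial_sum (fun nm => w alpha n0 nm.1 * w beta m0 nm.2) J <= _); last first.
  apply: ler_wpM2l; first exact: sqr_ge0.
  apply: partial_sum_prod_le => // n; exact: sum_inv_shifted_sqr.
rewrite !partial_sumE mulr_sumr ler_sum// => -[n m] _ /=.
have := chiM (alpha * (n%:R - n0%:R), beta * (m%:R - m0%:R)) => /=.
rewrite normrM !exprMn real_normK ?num_real// /w.
set x := alpha ^+ 2 * _; set y := beta ^+ 2 * _; set z : R := `|_|.
have x0 : 0 <= x by rewrite mulr_ge0 ?sqr_ge0.
have y0 : 0 <= y by rewrite mulr_ge0 ?sqr_ge0.
have z0 : 0 <= z by exact: normr_ge0.
move=> zM; rewrite -[leRHS]mulrA ler_wpM2l ?sqr_ge0//.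
rewrite -invfM ler_pdivlMr; last by rewrite mulr_gt0; lra.
(* With q = (1 + x)(1 + y) >= 1, q z^2 <= (q z)^2 <= M^2: one of the two factors 1/q given by the
   decay of the square suffices. *)
apply: le_trans (_ : ((1 + x) * (1 + y) * z) ^+ 2 <= _); last first.
  by rewrite ler_pXn2r// nnegrE; [|apply: le_trans zM]; rewrite !mulr_ge0//; lra.
have q1 : 1 <= (1 + x) * (1 + y) by nra.
rewrite exprMn mulrC ler_wpM2r ?sqr_ge0//.
by rewrite expr2 ler_peMr//; lra.
Qed.

(** * Characters and discrete Fourier inversion *)

Lemma expiD (R : realType) (x y : R) : expi (x + y) = expi x * expi y.
Proof. by rewrite /expi cosD sinD; simpc; congr (_ +i* _); rewrite addrC. Qed.

Lemma expi0 (R : realType) : expi (0 : R) = 1.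
Proof. by rewrite /expi cos0 sin0. Qed.

Lemma expiN_mul (R : realType) (x : R) : expi (- x) * expi x = 1.
Proof. by rewrite -expiD addNr expi0. Qed.

Lemma expi_mulrn (R : realType) (x : R) (k : nat) : expi (x *+ k) = expi x ^+ k.
Proof. by elim: k => [|k IH]; rewrite ?mulr0n ?expi0// mulrS exprS expiD IH. Qed.

Lemma expi_int (R : realType) (x : R) :
  x \is a Num.int -> expi (2 * pi * x) = 1.
Proof.
have e_nat (k : nat) : expi (2 * pi * k%:R : R) = 1.
  have e2pi : expi (2 * pi : R) = 1.
    by rewrite mulr_natl /expi cos2pi -[pi *+ 2]add0r sinD2pi sin0.
  by rewrite mulr_natr expi_mulrn e2pi expr1n.
case/intrP => -[k|k] ->; first exact: e_nat.
by have := expiN_mul (2 * pi * k.+1%:R : R); rewrite e_nat mulr1 NegzE mulrNz mulrN.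
Qed.

(** The real part is 1 - 2 sin^2(pi |x|), and the sine is positive because pi |x| lies strictly
    between 0 and pi. *)
Lemma expi_neq1 (R : realType) (x : R) : 0 < `|x| < 1 -> expi (2 * pi * x) != 1.
Proof.
move=> /andP[x0 x1]; rewrite /expi eq_complex/= negb_and; apply/orP; left.
have -> : cos (2 * pi * x) = cos ((pi * `|x|) *+ 2).
  rewrite -[in RHS]mulr_natl mulrA; case: (ger0P x) => // _.
  by rewrite mulrN cosN.
rewrite cos_mulr2n cos2sin2.
have : 0 < sin (pi * `|x|).
  apply: sin_gt0_pi; rewrite mulr_gt0 ?pi_gt0//=.
  by rewrite -[ltRHS]mulr1 ltr_pM2l ?pi_gt0.
by move: (sin _) => s s0; apply/eqP => /eqP; nra.
Qed.

(** For i <> j this is a geometric sum whose ratio [z] is an l-th root of unity, and [z] differs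
    from 1 because 0 < |i - j| / l < 1. *)
Lemma sum_expi_orthogonal (R : realType) (l : nat) (i j : 'I_l) :
  \sum_(k < l) expi (2 * pi * (k%:R * ((i%:R - j%:R) / l%:R)) : R)
  = (l * (i == j))%:R.
Proof.
have l_gt0 : (0 < l)%N by apply: leq_trans (ltn_ord i).
have l0 : (l%:R : R) != 0 by rewrite pnatr_eq0 -lt0n.
set z := expi (2 * pi * ((i%:R - j%:R) / l%:R) : R).
under eq_bigr => k _ do rewrite mulrCA [_ * (2 * pi * _)]mulr_natl expi_mulrn -/z.
have [ij|ij] := eqVneq i j.
  rewrite /z ij subrr mul0r mulr0 expi0.
  by under eq_bigr do rewrite expr1n; rewrite sumr_const card_ord muln1.
rewrite muln0.
have z1 : z != 1.
  apply: expi_neq1; rewrite normr_gt0 mulf_neq0 ?invr_eq0//=; last first.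
    by rewrite subr_eq0 eqr_nat.
  rewrite normrM normfV (ger0_norm (ler0n _ l)) ltr_pdivrMr ?ltr0n// mul1r.
  have il : i%:R < l%:R :> R by rewrite ltr_nat.
  have jl : j%:R < l%:R :> R by rewrite ltr_nat.
  have j0 : 0 <= j%:R :> R by []. have i0 : 0 <= i%:R :> R by [].
  by rewrite ltr_norml; apply/andP; split; lra.
have zl : z ^+ l = 1.
  rewrite -expi_mulrn.
  have -> : 2 * pi * ((i%:R - j%:R) / l%:R) *+ l = 2 * pi * (i%:R - j%:R : R).
    by rewrite -mulr_natr; field.
  by rewrite expi_int// rpredB// natr_int.
have := subrX1 z l; rewrite zl subrr => /esym/eqP.
by rewrite mulf_eq0 subr_eq0 (negPf z1) => /eqP.
Qed.

Lemma fourier_inversion (R : realType) (l : nat) (f : nat -> R[i]) :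
  (0 < l)%N -> (forall n, f (n + l)%N = f n) -> forall n,
  f n = l%:R^-1 * \sum_(k < l) (\sum_(j < l) f j * expi (2 * pi * k%:R * j%:R / l%:R))
                  * expi (- (2 * pi * k%:R * n%:R / l%:R)).
Proof.
move=> l_gt0 fl.
have l0 : (l%:R : R) != 0 by rewrite pnatr_eq0 -lt0n.
(* On a fundamental domain, exchanging the sums and applying orthogonality leaves only the term
   [j = n]. *)
have small (n : 'I_l) : f n = l%:R^-1 * \sum_(k < l)
    (\sum_(j < l) f j * expi (2 * pi * k%:R * j%:R / l%:R))
    * expi (- (2 * pi * k%:R * n%:R / l%:R)).
  under eq_bigr do rewrite mulr_suml.
  rewrite exchange_big/=.
  have -> : \sum_(j < l) \sum_(k < l) f j * expi (2 * pi * k%:R * j%:R / l%:R)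
      * expi (- (2 * pi * k%:R * n%:R / l%:R)) = \sum_(j < l) f j * (l * (j == n))%:R.
    apply: eq_bigr => j _; rewrite -(sum_expi_orthogonal R) mulr_sumr.
    apply: eq_bigr => k _; rewrite -mulrA -expiD; congr (_ * expi _).
    by field.
  rewrite (bigD1 n)//= eqxx muln1 big1 ?addr0 => [|j /negPf ->].
    by rewrite mulrCA mulVf ?mulr1// pnatr_eq0 -lt0n.
  by rewrite muln0 mulr0.
(* Both sides are l-periodic, so induction on the quotient of [n] by [l] reduces to the
   remainder. *)
move=> n; rewrite {1 2}(divn_eq n l) addnC.
elim: (n %/ l)%N => [|q IH].
  by rewrite mul0n addn0; apply: (small (Ordinal (ltn_pmod n l_gt0))).
rewrite mulSnr addnA fl IH; congr (_ * _); apply: eq_bigr => k _; congr (_ * _).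
rewrite [in RHS]natrD; set a : R := (_ + _)%:R.
have -> : - (2 * pi * k%:R * (a + l%:R) / l%:R) =
  - (2 * pi * k%:R * a / l%:R) + 2 * pi * (- k%:R) by field.
by rewrite expiD expi_int ?mulr1// rpredN natr_int.
Qed.

(** One-dimensional inversion in the first variable with [m] fixed, then in the second for each
    residue [i]. *)
Lemma fourier_inversion2 (R : realType) (l1 l2 : nat) (f : nat -> nat -> R[i]) :
  (0 < l1)%N -> (0 < l2)%N ->
  (forall n m, f (n + l1)%N m = f n m) -> (forall n m, f n (m + l2)%N = f n m) ->
  forall n m, f n m = \sum_(k1 < l1) \sum_(k2 < l2)
    ((l1%:R * l2%:R)^-1 * \sum_(i < l1) \sum_(j < l2) f i j
       * expi (2 * pi * k1%:R * i%:R / l1%:R)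
       * expi (2 * pi * k2%:R * j%:R / l2%:R))
    * (expi (- (2 * pi * k1%:R * n%:R / l1%:R))
       * expi (- (2 * pi * k2%:R * m%:R / l2%:R))).
Proof.
move=> l1_gt0 l2_gt0 f1 f2 n m.
rewrite [LHS](fourier_inversion l1_gt0 (f1^~ m)) mulr_sumr.
apply: eq_bigr => k1 _.
under eq_bigr => i _ do
  rewrite (fourier_inversion l2_gt0 (f2 i) m) mulr_sumr mulr_suml.
rewrite exchange_big/= mulr_suml mulr_sumr; apply: eq_bigr => k2 _.
rewrite mulr_suml mulr_sumr [in RHS]mulr_sumr [in RHS]mulr_suml invfM.
apply: eq_bigr => i _.
rewrite mulr_suml !mulr_sumr !mulr_suml !mulr_sumr.
by apply: eq_bigr => j _; rewrite !mulrA; ring.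
Qed.

(** * Nonvanishing of a polynomial at the lattice point nearest to (E1, E2) *)

(* The floor of E / (omega h) is a competitor within omega h / 2 of E. *)
Lemma nearest_level (R : realType) (omega h E : R) (n0 : nat) :
  0 < omega -> 0 < h -> 0 < E -> unique_nearest (level omega h) E n0 ->
  `|level omega h n0%:Z - E| <= omega * h.
Proof.
move=> w0 h0 E0 near_n0; have wh0 : 0 < omega * h by rewrite mulr_gt0.
set N := Num.truncn (E / (omega * h)).
have N_near : `|level omega h N%:Z - E| <= omega * h.
  have /Num.Theory.truncn_itv/andP[] : 0 <= E / (omega * h) by rewrite divr_ge0// ltW.
  rewrite -/N ler_pdivlMr// ltr_pdivrMr// -natr1 /level -pmulrn => NE EN.
  by rewrite ler_norml; apply/andP; split; lra.
have [<- //|/near_n0 /ltW] := eqVneq N n0.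
by move/le_trans; apply.
Qed.

Lemma continuous_horner2 (R : realType) (P : {poly {poly R}}) :
  continuous (fun p : R * R => P.[p.1%:P].[p.2]).
Proof.
move=> p; elim/poly_ind : P => [|P c IH].
  under eq_fun do rewrite !horner0; exact: cvg_cst.
under eq_fun do rewrite hornerMXaddC hornerD hornerM hornerC.
apply: cvgD; last by apply: continuous_comp; [exact: cvg_snd | exact: continuous_horner].
by apply: cvgM => //; exact: cvg_fst.
Qed.

Lemma horner2_near_neq0 (R : realType) (P : {poly {poly R}}) (x0 y0 : R) :
  P.[x0%:P].[y0] != 0 -> exists2 e : R, 0 < e &
    forall x y, `|x - x0| < e -> `|y - y0| < e -> P.[x%:P].[y] != 0.
Proof.
move=> P0.
have : \forall p \near ((x0, y0) : R * R), P.[p.1%:P].[p.2] != 0.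
  exact: (cvgr_neq0 _ (@continuous_horner2 R P (x0, y0))).
move=> /nbhs_ballP[e /= e0 Pe]; exists e => // x y xe ye.
by apply: (Pe (x, y)); split; rewrite /ball/= distrC.
Qed.

(** The nearest levels are within [omega1 * h] and [omega2 * h] of [E1] and [E2], so h < e / omega1
    and h < e / omega2 suffice; this threshold is uniform in [n0] and [m0]. *)
Lemma horner2_nearest_neq0 (R : realType) (omega1 omega2 E1 E2 : R)
    (P : {poly {poly R}}) :
  0 < omega1 -> 0 < omega2 -> 0 < E1 -> 0 < E2 -> P.[E1%:P].[E2] != 0 ->
  \forall h \near 0^'+, forall n0 m0 : nat,
    unique_nearest (level omega1 h) E1 n0 ->
    unique_nearest (level omega2 h) E2 m0 ->
    P.[(level omega1 h n0%:Z)%:P].[level omega2 h m0%:Z] != 0.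
Proof.
move=> w1 w2 E1_gt0 E2_gt0 /horner2_near_neq0[e e0 Pe].
near=> h => n0 m0 n0_near m0_near.
have h0 : 0 < h by near: h; exact: nbhs_right_gt.
apply: Pe.
  apply: le_lt_trans (nearest_level w1 h0 E1_gt0 n0_near) _.
  rewrite mulrC -ltr_pdivlMr//; near: h; apply: nbhs_right_lt.
  exact: divr_gt0.
apply: le_lt_trans (nearest_level w2 h0 E2_gt0 m0_near) _.
rewrite mulrC -ltr_pdivlMr//; near: h; apply: nbhs_right_lt.
exact: divr_gt0.
Unshelve. all: by end_near. Qed.

(** * Periodicity and Fourier expansion of [theta] *)

Lemma norm_expi (R : realType) (x : R) : `|expi x| = 1.
Proof. by rewrite normc_def/= cos2Dsin2 sqrtr1. Qed.

Lemma expi_congr_int (R : realType) (x y : R) :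
  y - x \is a Num.int -> expi (- (2 * pi * y)) = expi (- (2 * pi * x)).
Proof.
move=> xy_int.
have -> : - (2 * pi * y) = - (2 * pi * x) + 2 * pi * - (y - x) by ring.
by rewrite expiD expi_int ?mulr1// rpredN.
Qed.

(** The quantity assumed integral is exactly the increment of the quadratic phase when [n] becomes
    [n + l]. *)
Lemma theta_periodicl (R : realType) (rho1 rho2 rho12 : R) (n0 m0 l n m : nat) :
  rho1 * l%:R ^+ 2 + 2 * rho1 * l%:R * (n%:R - n0%:R)
    + rho12 * l%:R * (m%:R - m0%:R) \is a Num.int ->
  theta rho1 rho2 rho12 n0 m0 (n + l)%N%:Z m%:Z
    = theta rho1 rho2 rho12 n0 m0 n%:Z m%:Z.
Proof.
move=> l_int; rewrite /theta -!pmulrn natrD; apply: expi_congr_int.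
by move: l_int; congr (is_true (_ \is a Num.int)); ring.
Qed.

Lemma theta_periodicr (R : realType) (rho1 rho2 rho12 : R) (n0 m0 l n m : nat) :
  rho2 * l%:R ^+ 2 + 2 * rho2 * l%:R * (m%:R - m0%:R)
    + rho12 * l%:R * (n%:R - n0%:R) \is a Num.int ->
  theta rho1 rho2 rho12 n0 m0 n%:Z (m + l)%N%:Z
    = theta rho1 rho2 rho12 n0 m0 n%:Z m%:Z.
Proof.
move=> l_int; rewrite /theta -!pmulrn natrD; apply: expi_congr_int.
by move: l_int; congr (is_true (_ \is a Num.int)); ring.
Qed.

Lemma theta_fourier (R : realType) (rho1 rho2 rho12 : R) (n0 m0 l1 l2 : nat) :
  (0 < l1)%N -> (0 < l2)%N ->
  (forall n m : nat, rho1 * l1%:R ^+ 2 + 2 * rho1 * l1%:R * (n%:R - n0%:R)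
    + rho12 * l1%:R * (m%:R - m0%:R) \is a Num.int) ->
  (forall n m : nat, rho2 * l2%:R ^+ 2 + 2 * rho2 * l2%:R * (m%:R - m0%:R)
    + rho12 * l2%:R * (n%:R - n0%:R) \is a Num.int) ->
  forall n m : nat, theta rho1 rho2 rho12 n0 m0 n%:Z m%:Z =
    \sum_(k1 < l1) \sum_(k2 < l2) ccoef rho1 rho2 rho12 n0 m0 l1 l2 k1 k2 *
      (expi (- (2 * pi * k1%:R * (n%:R - n0%:R) / l1%:R)) *
       expi (- (2 * pi * k2%:R * (m%:R - m0%:R) / l2%:R))).
Proof.
move=> l1_gt0 l2_gt0 int1 int2 n m.
rewrite (@fourier_inversion2 _ l1 l2
  (fun n m : nat => theta rho1 rho2 rho12 n0 m0 n%:Z m%:Z)) //; last 2 first.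
- by move=> i j; rewrite theta_periodicl.
- by move=> i j; rewrite theta_periodicr.
apply: eq_bigr => k1 _; apply: eq_bigr => k2 _.
(* The bracket produced by the inversion formula is [bcoef] up to conversion; only its position in
   the product matters from here on. *)
rewrite /ccoef; set b := bcoef _ _ _ _ _ _ _ _ _; rewrite -[X in X * _ = _]/b; move: b => b.
(* Recentring the characters at [n0] and [m0] releases the two constant phases by which [ccoef]
   differs from [bcoef]. *)
have shift (k l x y : R) : expi (- (2 * pi * k * x / l)) =
    expi (- (2 * pi * k * y / l)) * expi (- (2 * pi * k * (x - y) / l)).
  by rewrite -expiD; congr expi; ring.
rewrite (shift _ _ n%:R n0%:R) (shift _ _ m%:R m0%:R).
by rewrite mulrACA mulrC [RHS]mulrAC.
Qed.

(** * The resonance identity *)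

(** Differences of levels are [omega * h * (n - n0)], so the coefficients sample [chi] on a lattice
    of steps [omega1 * h / h ^ delta1] and [omega2 * h / h ^ delta2]. *)
Lemma coef_sqr_partial_sum_bound (R : realType) (omega1 omega2 delta1 delta2 h : R)
    (chi : R * R -> R) (n0 m0 : nat) :
  schwartz chi -> 0 < omega1 -> 0 < omega2 -> 0 < h ->
  exists M : R, forall J : {fset nat * nat},
    partial_sum (fun nm => `|coef chi (level omega1 h) (level omega2 h) n0 m0 h
      delta1 delta2 nm.1%:Z nm.2%:Z| ^+ 2) J <= M.
Proof.
move=> chi_schwartz w1 w2 h0; rewrite /coef; set c := (l2norm _)^-1.
have p1 : 0 < h `^ delta1 by rewrite powR_gt0.
have p2 : 0 < h `^ delta2 by rewrite powR_gt0.
have [||M HM] := schwartz_lattice_sqr_bound (alpha := omega1 * h / h `^ delta1)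
  (beta := omega2 * h / h `^ delta2) c n0 m0 chi_schwartz.
- by rewrite lt0r_neq0// divr_gt0// mulr_gt0.
- by rewrite lt0r_neq0// divr_gt0// mulr_gt0.
exists M => J; apply: le_trans (HM J); rewrite le_eqVlt; apply/orP; left; apply/eqP.
congr (partial_sum _ J); apply/funext => -[n m]/=; rewrite /level -!pmulrn.
by congr (`|_ * chi (_, _)| ^+ 2); ring.
Qed.

(** The identity for any square-summable coefficients; the revival periods enter through the ratios
    of [T] to them. *)
Lemma a2_resonance (R : realType) (a : int -> int -> R) (M : R) (n0 m0 l1 l2 : nat)
    (Tscl1 Tscl2 Trev1 Trev2 Trev12 T rho1 rho2 rho12 : R) :
  (forall J : {fset nat * nat},
     partial_sum (fun nm => `|a nm.1%:Z nm.2%:Z| ^+ 2) J <= M) ->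
  Tscl1 != 0 -> Tscl2 != 0 ->
  T / Trev1 = rho1 -> T / Trev2 = rho2 -> T / Trev12 = rho12 ->
  (0 < l1)%N -> (0 < l2)%N ->
  (forall n m : nat, rho1 * l1%:R ^+ 2 + 2 * rho1 * l1%:R * (n%:R - n0%:R)
    + rho12 * l1%:R * (m%:R - m0%:R) \is a Num.int) ->
  (forall n m : nat, rho2 * l2%:R ^+ 2 + 2 * rho2 * l2%:R * (m%:R - m0%:R)
    + rho12 * l2%:R * (n%:R - n0%:R) \is a Num.int) ->
  a2 a n0 m0 Tscl1 Tscl2 Trev1 Trev2 Trev12 T =
  \sum_(k1 < l1) \sum_(k2 < l2) ccoef rho1 rho2 rho12 n0 m0 l1 l2 k1 k2 *
    psi_cl a n0 m0 Tscl1 Tscl2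
      (T + k1%:R / l1%:R * Tscl1) (T + k2%:R / l2%:R * Tscl2).
Proof.
move=> aM Tscl1_neq0 Tscl2_neq0 TE1 TE2 TE12 l1_gt0 l2_gt0 int1 int2.
have l1_neq0 : l1%:R != 0 :> R by rewrite pnatr_eq0 -lt0n.
have l2_neq0 : l2%:R != 0 :> R by rewrite pnatr_eq0 -lt0n.
(* Unimodular phases leave the moduli unchanged, so one bound serves every shifted [psi_cl]. *)
have cvg_phase (phase : nat -> nat -> R) : cvg ((partial_sum (fun nm : nat * nat =>
    (`|a nm.1%:Z nm.2%:Z| ^+ 2)%:C * expi (phase nm.1 nm.2)) : _ -> R[i]^o) @ totally).
  apply: partial_sum_cvg_complex aM => -[n m] /=.
  rewrite normrM norm_expi mulr1 normc_def/= expr0n addr0 sqrtr_sqr.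
  by rewrite ger0_norm// sqr_ge0.
rewrite pair_bigA/= /a2 /psi_cl -sum2_lincomb; last first.
  move=> -[k1 k2]; exact: (cvg_phase (fun n m =>
    - (2 * pi * (T + k1%:R / l1%:R * Tscl1) * ((n%:R - n0%:R) / Tscl1))
    - 2 * pi * (T + k2%:R / l2%:R * Tscl2) * ((m%:R - m0%:R) / Tscl2))).
congr sum2; apply/funext => n; apply/funext => m /=.
(* The linear part of the phase is kept apart; the quadratic part at time [T] is [theta]. *)
transitivity ((`|a n%:Z m%:Z| ^+ 2)%:C *
  expi (- (2 * pi * T * ((n%:R - n0%:R) / Tscl1 + (m%:R - m0%:R) / Tscl2))) *
  theta rho1 rho2 rho12 n0 m0 n%:Z m%:Z).
  rewrite /theta -[RHS]mulrA -expiD -!pmulrn; congr (_ * expi _).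
  by rewrite -TE1 -TE2 -TE12; ring.
rewrite (theta_fourier l1_gt0 l2_gt0 int1 int2) pair_bigA mulr_sumr.
apply: eq_bigr => -[k1 k2] _ /=.
(* Shifting a time by (k / l) Tscl adds -2 pi k (n - n0) / l to the phase after [Tscl] cancels,
   which is the recentred character. *)
rewrite mulrCA -[X in _ * X = _]mulrA -!expiD; congr (_ * (_ * expi _)).
by field; rewrite ?Tscl1_neq0 ?Tscl2_neq0 ?l1_neq0 ?l2_neq0.
Qed.

Unset Implicit Arguments.
Set Strict Implicit.

Theorem corollary4p17 (R : realType) (omega1 omega2 : R)
    (F : {poly {poly R}}) (E1 E2 delta1 delta2 : R) (chi : R * R -> R)
    (omega1_gt0 : 0 < omega1) (omega2_gt0 : 0 < omega2)
    (E1_range : 0 < E1 <= 1) (E2_range : 0 < E2 <= 1)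
    (delta1_range : 0 < delta1 < 1) (delta2_range : 0 < delta2 < 1)
    (chi_schwartz : schwartz chi) (chi_ge0 : forall p, 0 <= chi p)
    (chi_neq0 : exists p, chi p != 0)
    (FX_neq0 : (dX F).[E1%:P].[E2] != 0) (FY_neq0 : (dY F).[E1%:P].[E2] != 0)
    (FXX_neq0 : (dX (dX F)).[E1%:P].[E2] != 0)
    (FXY_neq0 : (dX (dY F)).[E1%:P].[E2] != 0)
    (FYY_neq0 : (dY (dY F)).[E1%:P].[E2] != 0) :
  \forall h \near 0^'+,
    let tau := level omega1 h in
    let mu := level omega2 h in
    forall n0 m0 : nat, unique_nearest tau E1 n0 -> unique_nearest mu E2 m0 ->
    let a := coef chi tau mu n0 m0 h delta1 delta2 in
    let Tscl1 := 2 * pi / (omega1 * (dX F).[(tau n0%:Z)%:P].[mu m0%:Z]) in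
    let Tscl2 := 2 * pi / (omega2 * (dY F).[(tau n0%:Z)%:P].[mu m0%:Z]) in
    let Trev1 := 4 * pi / (h * omega1 ^+ 2 * (dX (dX F)).[E1%:P].[E2]) in
    let Trev2 := 4 * pi / (h * omega2 ^+ 2 * (dY (dY F)).[E1%:P].[E2]) in
    let Trev12 := 4 * pi / (h * (omega1 * omega2) * (dX (dY F)).[E1%:P].[E2]) in
    forall p1 q1 p2 q2 p12 q12 : int,
    p1 != 0 -> q1 != 0 -> p2 != 0 -> q2 != 0 -> p12 != 0 -> q12 != 0 ->
    let rho1 : R := p1%:~R / q1%:~R in
    let rho2 : R := p2%:~R / q2%:~R in
    let rho12 : R := p12%:~R / q12%:~R in
    forall Tfrac : R,
    rho1 * Trev1 = Tfrac -> rho2 * Trev2 = Tfrac -> rho12 * Trev12 = Tfrac ->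
    let r1 := p12 * q1 in let s1 := q12 * p1 in
    let r2 := p12 * q2 in let s2 := q12 * p2 in
    forall l1 l2 : nat, (1 <= l1)%N -> (1 <= l2)%N ->
    (forall n m : int,
       ((l1%:R ^+ 2 * p1%:~R) / q1%:~R
        + (2 * p1%:~R * l1%:R) / q1%:~R * n%:~R
        + (p1%:~R * r1%:~R * l1%:R) / (s1%:~R * q1%:~R) * m%:~R : R)
         \is a Num.int /\
       ((l2%:R ^+ 2 * p2%:~R) / q2%:~R
        + (2 * p2%:~R * l2%:R) / q2%:~R * m%:~R
        + (p2%:~R * r2%:~R * l2%:R) / (s2%:~R * q2%:~R) * n%:~R : R)
         \is a Num.int) ->
    a2 a n0 m0 Tscl1 Tscl2 Trev1 Trev2 Trev12 Tfrac =
    \sum_(k1 < l1) \sum_(k2 < l2)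
      ccoef rho1 rho2 rho12 n0 m0 l1 l2 k1 k2 *
      psi_cl a n0 m0 Tscl1 Tscl2
        (Tfrac + k1%:R / l1%:R * Tscl1) (Tfrac + k2%:R / l2%:R * Tscl2).
Proof.
have [E1_gt0 E2_gt0] : 0 < E1 /\ 0 < E2 by case/andP: E1_range; case/andP: E2_range.
near=> h.
have h_gt0 : 0 < h by near: h; exact: nbhs_right_gt.
move=> n0 m0 tau_n0 mu_m0 p1 q1 p2 q2 p12 q12.
move=> p1_neq0 q1_neq0 p2_neq0 q2_neq0 p12_neq0 q12_neq0.
move=> T rho1T rho2T rho12T l1 l2 l1_gt0 l2_gt0 int.
have FX0 : (dX F).[(level omega1 h n0%:Z)%:P].[level omega2 h m0%:Z] != 0.
  (* [n0] and [m0] depend on [h], so they are generalized before the smallness of [h] is invoked. *)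
  move: n0 m0 tau_n0 mu_m0 {rho1T rho2T rho12T int}; near: h.
  exact: horner2_nearest_neq0.
have FY0 : (dY F).[(level omega1 h n0%:Z)%:P].[level omega2 h m0%:Z] != 0.
  move: n0 m0 tau_n0 mu_m0 {rho1T rho2T rho12T int FX0}; near: h.
  exact: horner2_nearest_neq0.
have pi_neq0 : pi != 0 :> R by rewrite lt0r_neq0// pi_gt0.
have w1_neq0 : omega1 != 0 by rewrite lt0r_neq0.
have w2_neq0 : omega2 != 0 by rewrite lt0r_neq0.
have h_neq0 : h != 0 by rewrite lt0r_neq0.
have [P1 Q1 P2 Q2 Q12] : [/\ p1%:~R != 0 :> R, q1%:~R != 0 :> R, p2%:~R != 0 :> R,
    q2%:~R != 0 :> R & q12%:~R != 0 :> R] by rewrite !intr_eq0.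
have [M aM] := coef_sqr_partial_sum_bound delta1 delta2 n0 m0 chi_schwartz
  omega1_gt0 omega2_gt0 h_gt0.
apply: (a2_resonance aM) => //.
(* As the inverse of 0 is 0, a vanishing derivative would make the period 0; [FX0] and [FY0] exclude
   this. *)
- by rewrite !(mulf_neq0, invr_neq0)// pnatr_eq0.
- by rewrite !(mulf_neq0, invr_neq0)// pnatr_eq0.
(* Each ratio of [T] to a revival period is the matching [rho], the second derivatives being
   nonzero. *)
- by rewrite -rho1T mulfK// !(mulf_neq0, invr_neq0, expf_neq0)// pnatr_eq0.
- by rewrite -rho2T mulfK// !(mulf_neq0, invr_neq0, expf_neq0)// pnatr_eq0.
- by rewrite -rho12T mulfK// !(mulf_neq0, invr_neq0, expf_neq0)// pnatr_eq0.
(* Integrality is used at (i - n0, j - m0), and p1 r1 / (s1 q1) reduces to p12 / q12. *)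
- move=> i j; have [+ _] := int (i%:Z - n0%:Z) (j%:Z - m0%:Z).
  rewrite !intrB -!pmulrn; congr (is_true (_ \is a Num.int)).
  by rewrite !intrM; field; rewrite ?P1 ?Q1 ?Q12.
- move=> i j; have [_] := int (i%:Z - n0%:Z) (j%:Z - m0%:Z).
  rewrite !intrB -!pmulrn; congr (is_true (_ \is a Num.int)).
  by rewrite !intrM; field; rewrite ?P2 ?Q2 ?Q12.
Unshelve. all: by end_near. Qed.
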